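(* Let $R$ be a multiplicative hyperring in which every prime hyperideal is maximal, and let $I$ be a hyperideal of $R$ such that $I\subseteq J(R)$. Then $I$ is quasi $J$-prime if and only if $R$ is local with maximal hyperideal $\sqrt{I}$.
   Context: A multiplicative hyperring is a nonempty set $R$ with an operation $+$ and a hyperoperation $\circ: R\times R\to P^*(R)$ (where $P^*(R)$ is the set of nonempty subsets of $R$) such that: $(R,+)$ is an abelian group; $\circ$ is associative; $a\circ(b+c)\subseteq a\circ b+a\circ c$ and $(b+c)\circ a\subseteq b\circ a+c\circ a$; and $a\circ(-b)=(-a)\circ b=-(a\circ b)$ for all $a,b,c\in R$. For nonempty subsets $A,B\subseteq R$, $A\circ B=\bigcup_{x\in A,\,y\in B}x\circ y$, and $A\circ r=A\circ\{r\}$. Standing assumptions: $R$ is commutative with an identity $1$, meaning $a\in a\circ 1$ for all $a\in R$. A hyperideal of $R$ is a nonempty subset $I\subseteq R$ with $a-b\in I$ for $a,b\in I$ and $r\circ x\subseteq I$ for $x\in I$, $r\in R$. Let $\mathbf{C}=\{r_1\circ r_2\circ\cdots\circ r_n : r_i\in R,\ n\in\mathbb{N}\}$; a hyperideal $I$ is a $\mathbf{C}$-hyperideal if for every $A\in\mathbf{C}$, $A\cap I\neq\varnothing$ implies $A\subseteq I$. Standing assumption: all hyperideals are $\mathbf{C}$-hyperideals. A proper hyperideal $M$ is maximal if every hyperideal $N$ with $M\subsetneq N\subseteq R$ equals $R$; $R$ is local if it has just one maximal hyperideal; the Jacobson radical $J(R)$ is the intersection of all maximal hyperideals of $R$. A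 proper hyperideal $P$ is prime if $x\circ y\subseteq P$ with $x,y\in R$ implies $x\in P$ or $y\in P$. $\sqrt{I}$ is the intersection of all prime hyperideals of $R$ containing $I$ (and $\sqrt{I}=R$ if there are none). A proper hyperideal $I$ is $J$-prime if for all $x,y\in R$, $x\circ y\subseteq I$ implies $x\in J(R)$ or $y\in I$. A proper hyperideal $I$ is quasi $J$-prime if $\sqrt{I}$ is $J$-prime. *)

(* Defs.v *)
From HB Require Import structures.
From mathcomp Require Import all_boot all_order all_algebra.
From mathcomp Require Import boolp classical_sets.

Set Implicit Arguments.
Unset Strict Implicit.
Unset Printing Implicit Defensive.

Import GRing.Theory.
Local Open Scope classical_set_scope.
Local Open Scope ring_scope.

(* The set-level product A o B induced by an operation T -> T -> set T. *)
Definition set_hmul (T : Type) (op : T -> T -> set T) (A B : set T) : set T :=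
  \bigcup_(x in A) \bigcup_(y in B) op x y.

HB.mixin Record isMultHyperring R of GRing.Zmodule R := {
  hmul : R -> R -> set R;
  hmul_neq0 : forall a b, hmul a b !=set0;
  hmulA : forall a b c,
    set_hmul hmul (hmul a b) [set c] = set_hmul hmul [set a] (hmul b c);
  hmulDr : forall a b c,
    hmul a (b + c) `<=` [set x + y | x in hmul a b & y in hmul a c];
  hmulDl : forall a b c,
    hmul (b + c) a `<=` [set x + y | x in hmul b a & y in hmul c a];
  hmulrN : forall a b, hmul a (- b) = [set - x | x in hmul a b];
  hmulNr : forall a b, hmul (- a) b = [set - x | x in hmul a b]
}.

#[short(type="multHyperringType")]
HB.structure Definition MultHyperring :=
  { R of isMultHyperring R & GRing.Zmodule R }.

HB.mixin Record MultHyperring_isComUnital R of MultHyperring R := {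
  hone : R;
  hmulC : forall a b : R, hmul a b = hmul b a;
  mem_hmul1 : forall a : R, hmul a hone a
}.

#[short(type="comMultHyperringType")]
HB.structure Definition ComMultHyperring :=
  { R of MultHyperring_isComUnital R & MultHyperring R }.

Section Hyperideals.
Variable R : comMultHyperringType.
Implicit Types (I M P : set R).

Definition hyperideal I : Prop :=
  [/\ I !=set0,
      forall a b, I a -> I b -> I (a - b)
    & forall r x, I x -> hmul r x `<=` I].

(* r o r_1 o ... o r_n for s = [:: r_1; ...; r_n]; products of at least one
   factor, a single factor giving the singleton [set r]. *)
Definition hprod (r : R) (s : seq R) : set R :=
  foldl (fun A x => set_hmul hmul A [set x]) [set r] s.

Definition C_hyperideal I : Prop :=
  hyperideal I /\
  forall r s, hprod r s `&` I !=set0 -> hprod r s `<=` I.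

Definition proper_hyperideal I : Prop := hyperideal I /\ I <> setT.

Definition maximal_hyperideal M : Prop :=
  proper_hyperideal M /\
  forall N : set R, hyperideal N -> M `<` N -> N = setT.

Definition prime_hyperideal P : Prop :=
  proper_hyperideal P /\
  forall x y, hmul x y `<=` P -> P x \/ P y.

Definition jacobson : set R := \bigcap_(M in maximal_hyperideal) M.

(* Empty intersections are setT, so this is setT when no prime contains I. *)
Definition hradical I : set R :=
  \bigcap_(P in [set P | prime_hyperideal P /\ I `<=` P]) P.

Definition J_prime I : Prop :=
  proper_hyperideal I /\
  forall x y, hmul x y `<=` I -> jacobson x \/ I y.

Definition quasi_J_prime I : Prop :=
  proper_hyperideal I /\ J_prime (hradical I).

End Hyperideals.

Arguments jacobson R : clear implicits.

Definition local_hyperring (R : comMultHyperringType) : Prop :=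
  exists! M : set R, maximal_hyperideal M.

(* Main.v *)
Require Import Defs.
From mathcomp Require Import all_boot all_order all_algebra.
From mathcomp Require Import boolp classical_sets.

Local Open Scope classical_set_scope.

(** Maximal hyperideals are always prime, by the colon argument below. If
    conversely every prime is maximal, then the radical of a hyperideal lying
    inside [jacobson R] is an intersection over all maximal hyperideals, that
    is [jacobson R] itself ([hradical_eq_jacobson]). For this particular
    hyperideal, being J-prime is literally being prime, and being prime is the
    same as being maximal. Finally, [jacobson R] lies in every maximal
    hyperideal, so as soon as it is maximal it is the only one
    ([local_of_maximal_jacobson]). *)

Section Maximal.
Variable R : comMultHyperringType.
Implicit Types I M : set R.
Local Open Scope ring_scope.

Lemma hyperideal_opp I a : hyperideal I -> I a -> I (- a).
Proof.
move=> [_ Isub _] Ia; rewrite -GRing.sub0r.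
by apply: (Isub) => //; rewrite -(GRing.subrr a); exact: Isub.
Qed.

Lemma hyperideal_add I a b : hyperideal I -> I a -> I b -> I (a + b).
Proof.
move=> hI Ia Ib; have [_ Isub _] := hI.
by rewrite -(GRing.opprK b); apply: Isub => //; exact: hyperideal_opp.
Qed.

(** The colon (I : y); it replaces the sum of I and the hyperideal generated by
    an element, which would require finite sums of hyperproducts. *)
Definition colon I (y : R) : set R := [set z | hmul z y `<=` I].

Lemma sub_colon I y : hyperideal I -> I `<=` colon I y.
Proof. by move=> [_ _ Imul] z Iz; rewrite /colon /= hmulC; exact: Imul. Qed.

(** Although distributivity is only an inclusion, it goes in the direction
    needed here: a product with a sum is covered by sums of products. *)
Lemma hyperideal_colon I y : hyperideal I -> hyperideal (colon I y).
Proof.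
move=> hI; have [[i Ii] _ Imul] := hI; split.
- by exists i; exact: sub_colon.
- move=> a b aI bI z /hmulDl[u auy [v bvy <-]].
  apply: hyperideal_add => //; first exact: aI.
  move: bvy; rewrite hmulNr => -[w bw <-].
  by apply: hyperideal_opp => //; exact: bI.
- move=> r x xI z rxz w zyw.
  have : set_hmul hmul (hmul r x) [set y] w by exists z => //; exists y.
  rewrite hmulA => -[_ -> [u xyu ruw]].
  exact: (Imul r u (xI u xyu)) ruw.
Qed.

(** If [hmul x y] lies in M and x does not, then (M : y) is strictly larger
    than M, so it contains the identity, which forces y into M. *)
Lemma prime_of_maximal M : maximal_hyperideal M -> prime_hyperideal M.
Proof.
move=> [Mproper Mmax]; have [hM _] := Mproper.
split=> // x y xyM; have [Mx|nMx] := pselect (M x); [by left|right].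
have colonT : colon M y = setT.
  apply: Mmax; first exact: hyperideal_colon.
  by split; [exact: sub_colon|move=> /(_ x xyM)].
have : colon M y hone by rewrite colonT.
by apply; rewrite hmulC; exact: mem_hmul1.
Qed.

Lemma hradical_eq_jacobson I :
    (forall P : set R, prime_hyperideal P -> maximal_hyperideal P) ->
  I `<=` jacobson R -> hradical I = jacobson R.
Proof.
move=> prime_max IJ; apply/seteqP; split=> x.
- move=> radx M maxM; apply: radx; split; first exact: prime_of_maximal.
  by move=> z /IJ; apply.
- by move=> Jx P [/prime_max maxP _]; exact: Jx.
Qed.

Lemma local_of_maximal_jacobson :
  maximal_hyperideal (jacobson R) -> local_hyperring R.
Proof.
move=> maxJ; exists (jacobson R); split=> // M maxM.
have JM : jacobson R `<=` M by move=> x; apply.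
apply/seteqP; split=> //; apply: contrapT => nMJ.
have [[hM MT] _] := maxM; have [_ Jmax] := maxJ.
by apply: MT; apply: Jmax.
Qed.

End Maximal.

Theorem theorem4p13 (R : comMultHyperringType)
    (hyperidealC : forall K : set R, hyperideal K -> C_hyperideal K)
    (prime_maximal : forall P : set R,
       prime_hyperideal P -> maximal_hyperideal P)
    (I : set R) (hI : hyperideal I) (I_sub_J : I `<=` jacobson R) :
  quasi_J_prime I <-> local_hyperring R /\ maximal_hyperideal (hradical I).
Proof.
rewrite /quasi_J_prime (hradical_eq_jacobson _ _ prime_maximal I_sub_J).
(* [J_prime (jacobson R)] unfolds to [prime_hyperideal (jacobson R)]. *)
split=> [[_ /prime_maximal maxJ]|[_ maxJ]].
  by split=> //; exact: local_of_maximal_jacobson.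
split; last exact: prime_of_maximal.
split=> // IT; have [[_ JT] _] := maxJ; apply: JT.
by apply/seteqP; split=> // x _; apply: I_sub_J; rewrite IT.
Qed.
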